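(* Let $A$ and $B$ be nonempty closed and convex subsets of a reflexive and strictly convex Banach space $X$ which has property $(H)$. Let $T:A\cup B\to A\cup B$ be a cyclic contraction map. Then, for every $b\in B$, the sequence of iterates $\{T^{2n}(b)\}$ converges to $b_0$, the unique best proximity point of $T$ in $B$.
   Context: $\operatorname{dist}(A,B)=\inf\{\|x-y\|: x\in A,\ y\in B\}$. $T:A\cup B\to A\cup B$ is a cyclic contraction if $T(A)\subseteq B$, $T(B)\subseteq A$, and there is $k\in(0,1)$ such that $\|Tx-Ty\|\le k\|x-y\|+(1-k)\operatorname{dist}(A,B)$ for all $x\in A$, $y\in B$. A point $x\in A\cup B$ is a best proximity point for $T$ if $\|x-Tx\|=\operatorname{dist}(A,B)$; under the stated hypotheses $T$ has exactly one best proximity point in $B$, denoted $b_0$. A Banach space $X$ has property $(H)$ if weak and norm convergence coincide for sequences on the unit sphere of $X$; that is, if $\|x_n\|=\|x\|=1$ and $x_n\rightharpoonup x$ weakly, then $x_n\to x$ in norm. *)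

(* Defs.v *)
From HB Require Import structures.
From mathcomp Require Import all_boot all_order all_algebra.
From mathcomp Require Import all_classical all_reals all_analysis.

Set Implicit Arguments.
Unset Strict Implicit.
Unset Printing Implicit Defensive.

Import Order.TTheory GRing.Theory Num.Theory.
Import numFieldNormedType.Exports.

Local Open Scope classical_set_scope.
Local Open Scope ring_scope.

(* The dual and the bidual are given as sets of functions; linear combinations
   of functionals are those of the function space [X -> R^o]. *)
Definition dual (R : realType) (X : normedModType R) : set (X -> R^o) :=
  [set f | linear f /\ continuous f].

Definition dual_norm (R : realType) (X : normedModType R) (f : X -> R^o) : R :=
  sup [set `|f x| | x in [set x : X | `|x| <= 1]].

(* Only the values of [Phi] on [dual X] are meaningful: a bounded linear
   functional on the dual is represented by any of its extensions to all
   functions. *)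
Definition bidual (R : realType) (X : normedModType R) :
    set ((X -> R^o) -> R) :=
  [set Phi |
    (forall (a : R) (f g : X -> R^o), dual f -> dual g ->
       Phi (a *: f + g) = a * Phi f + Phi g) /\
    (exists M : R, forall f : X -> R^o, dual f -> `|Phi f| <= M * dual_norm f)].

(* The canonical embedding of [X] into its bidual is onto. *)
Definition reflexive_space (R : realType) (X : normedModType R) : Prop :=
  forall Phi : (X -> R^o) -> R, bidual Phi ->
    exists x : X, forall f : X -> R^o, dual f -> Phi f = f x.

Definition strictly_convex (R : realType) (X : normedModType R) : Prop :=
  forall x y : X, `|x| = 1 -> `|y| = 1 -> x != y -> `|2^-1 *: (x + y)| < 1.

Definition weakly_cvg (R : realType) (X : normedModType R)
    (u : nat -> X) (x : X) : Prop :=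
  forall f : X -> R^o, dual f -> f (u n) @[n --> \oo] --> f x.

Definition property_H (R : realType) (X : normedModType R) : Prop :=
  forall (u : nat -> X) (x : X), (forall n, `|u n| = 1) -> `|x| = 1 ->
    weakly_cvg u x -> u n @[n --> \oo] --> x.

Definition set_dist (R : realType) (X : normedModType R) (A B : set X) : R :=
  inf [set `|x - y| | x in A & y in B].

(* A map of [A `|` B] into itself is represented by a map [T] of the whole
   space, of which only the values on [A `|` B] matter. *)
Definition cyclic_contraction (R : realType) (X : normedModType R)
    (A B : set X) (T : X -> X) : Prop :=
  [/\ T @` A `<=` B, T @` B `<=` A &
    exists k : R, [/\ 0 < k, k < 1 &
      forall x y : X, A x -> B y ->
        `|T x - T y| <= k * `|x - y| + (1 - k) * set_dist A B]].

Definition best_proximity_points (R : realType) (X : normedModType R)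
    (A B : set X) (T : X -> X) : set X :=
  [set x | (A `|` B) x /\ `|x - T x| = set_dist A B].

(* Main.v *)
(* Let d = dist(A, B) and C = A - B, a convex set on which the norm is at least
   d. A minimizing sequence u of C is bounded, so by reflexivity it has a weak
   limit z along every ultrafilter. Hahn-Banach provides f of norm at most 1
   with f >= d on C, whence f z = d = |z|; by strict convexity z does not depend
   on the ultrafilter, so u converges weakly to z, without any appeal to the
   Eberlein-Smulian theorem, and property (H) makes the convergence strong.
   Thus x - y is close to z as soon as x in A and y in B satisfy |x - y| close
   to d. The excess |x - y| - d is contracted by the factor k under T, which
   makes the even iterates Cauchy; their limit is a best proximity point, and
   any two such points of B agree because their translates by z do. *)
Require Import Defs.
From HB Require Import structures.
From mathcomp Require Import all_boot all_order all_algebra.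
From mathcomp Require Import all_classical all_reals all_analysis.
From mathcomp Require Import lra.

Set Implicit Arguments.
Unset Strict Implicit.
Unset Printing Implicit Defensive.

Import Order.TTheory GRing.Theory Num.Theory.
Import numFieldNormedType.Exports.

Local Open Scope classical_set_scope.
Local Open Scope ring_scope.

(** * Sublinear functionals and the Hahn-Banach theorem *)

Definition sublinear (R : realType) (X : lmodType R) (q : X -> R) :=
  (forall x y, q (x + y) <= q x + q y) /\
  (forall t x, 0 <= t -> q (t *: x) = t * q x).

Lemma convex_setP (R : realType) (X : lmodType R) (C : set X) :
  convex_set (C : set (convex_lmodType X)) <->
  forall x y t, C x -> C y -> 0 <= t <= 1 -> C (t *: x + (1 - t) *: y).
Proof.
split=> [cC x y t Cx Cy t01|cC x y t /set_mem Cx /set_mem Cy].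
  have := cC x y (Itv01 (andP t01).1 (andP t01).2) (mem_set Cx) (mem_set Cy).
  by move/set_mem.
by apply/mem_set/cC => //; rewrite ge0 le1.
Qed.

Lemma convex_set_singleton (R : realType) (X : lmodType R) (x : X) :
  convex_set ([set x] : set (convex_lmodType X)).
Proof.
by apply/convex_setP => _ _ t -> -> _; rewrite -scalerDl addrC subrK scale1r.
Qed.

Lemma sublinear0 (R : realType) (X : lmodType R) (q : X -> R) :
  sublinear q -> q 0 = 0.
Proof. by case=> _ /(_ 0 0 (lexx _)); rewrite scale0r mul0r. Qed.

Lemma sublinearN (R : realType) (X : lmodType R) (q : X -> R) (x : X) :
  sublinear q -> - q (- x) <= q x.
Proof.
move=> sq; rewrite -subr_ge0 opprK -(sublinear0 sq) -(subrr x).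
exact: sq.1.
Qed.

(* The infimal convolution [q' x = inf_(t >= 0, c in C) (q (x + t c) - t m)]. *)
Lemma sublinear_separation (R : realType) (X : lmodType R) (q : X -> R)
    (C : set X) (m : R) :
  sublinear q -> C !=set0 -> convex_set (C : set (convex_lmodType X)) ->
  (forall c, C c -> m <= q c) ->
  exists q', [/\ sublinear q', (forall x, q' x <= q x) &
    forall c, C c -> q' (- c) <= - m].
Proof.
move=> sq [c0 Cc0] cC mC; have [qD qZ] := sq.
pose S x := [set r | exists t c, [/\ 0 <= t, C c & r = q (x + t *: c) - t * m]].
pose q' x := inf (S x).
have S0 x : S x !=set0.
  by exists (q (x + 0 *: c0) - 0 * m), 0, c0; split.
(* The infimum is finite because [t * m <= q (t *: c) <= q (x + t *: c) + q (- x)]. *)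
have Slb x : lbound (S x) (- q (- x)).
  move=> _ [t [c [t0 Cc ->]]].
  have : q (t *: c) <= q (x + t *: c) + q (- x).
    by rewrite (le_trans _ (qD _ _))// addrAC subrr add0r.
  have : t * m <= t * q c by rewrite ler_wpM2l// mC.
  rewrite qZ//; lra.
have hS x : has_inf (S x) by split=> //; exists (- q (- x)); exact: Slb.
have Sle x t c : 0 <= t -> C c -> q' x <= q (x + t *: c) - t * m.
  by move=> t0 Cc; apply: ge_inf; [exact: (hS x).2|exists t, c].
have q'q x : q' x <= q x.
  by have := Sle x 0 c0 (lexx _) Cc0; rewrite scale0r mul0r addr0 subr0.
have q'Z t x : 0 < t -> q' (t *: x) <= t * q' x.
  move=> t0; rewrite -ler_pdivrMl//; apply: lb_le_inf => //.
  move=> _ [s [c [s0 Cc ->]]]; rewrite ler_pdivrMl//.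
  have := Sle (t *: x) (t * s) c (mulr_ge0 (ltW t0) s0) Cc.
  by rewrite -scalerA -scalerDr (qZ _ _ (ltW t0)) mulrBr mulrA.
have q'0 : q' 0 = 0.
  apply/le_anti/andP; split; first by rewrite (le_trans (q'q _))// sublinear0.
  apply: lb_le_inf => // r /Slb; rewrite oppr0 sublinear0// oppr0; exact.
exists q'; split=> //; last first.
  move=> c Cc; have := Sle (- c) 1 c ler01 Cc.
  by rewrite scale1r addNr sublinear0// mul1r sub0r.
split; last first.
  move=> t x; rewrite le_eqVlt => /predU1P[<-|t0].
    by rewrite scale0r mul0r.
  apply/le_anti; rewrite q'Z//=.
  have := q'Z t^-1 (t *: x); rewrite invr_gt0 => /(_ t0).
  by rewrite scalerA mulVf ?gt_eqF// scale1r ler_pdivlMl.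
move=> x y; rewrite -lerBlDr; apply: lb_le_inf => // _ [t [c [t0 Cc ->]]].
rewrite lerBlDr -lerBlDl; apply: lb_le_inf => // _ [s [d [s0 Cd ->]]].
rewrite lerBlDl.
(* Convexity turns [t *: c + s *: d] into [t + s] times one point of [C], with weight [t / (t + s)];
   the case [t = s = 0] is treated apart. *)
have [ts0|ts0] := eqVneq (t + s) 0.
  have -> : t = 0 by lra.
  have -> : s = 0 by lra.
  rewrite !scale0r !mul0r !addr0 !subr0 addrC.
  by rewrite (le_trans (q'q _))// addrC.
have ts : 0 < t + s by rewrite lt_neqAle eq_sym ts0 addr_ge0.
pose l := t / (t + s).
have Cl : C (l *: c + (1 - l) *: d).
  have/convex_setP := cC; apply => //; rewrite divr_ge0 ?(ltW ts)//=.
  by rewrite ler_pdivrMr// mul1r lerDl.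
have := Sle (x + y) _ _ (ltW ts) Cl.
rewrite scalerDr !scalerA mulrBr mulr1 /l mulrCA divff// mulr1.
rewrite [t + s - t]addrC addKr addrACA.
have := qD (x + t *: c) (y + s *: d); lra.
Qed.

(* A minimal sublinear functional q is linear: separating the point x in
   [sublinear_separation] cannot decrease q, hence q (- x) <= - q x. *)
Lemma sublinear_ge_linear (R : realType) (X : lmodType R) (p : X -> R) :
  sublinear p -> exists f : X -> R^o, linear f /\ forall x, f x <= p x.
Proof.
move=> sp.
pose E := {q : X -> R | sublinear q /\ forall x, q x <= p x}.
(* The order is reversed, so that a maximal element from Zorn's lemma is a minimal sublinear
   functional below [p]. *)
pose le (q1 q2 : E) := `[< forall x, sval q2 x <= sval q1 x >].
have le_asym : forall q1 q2, le q1 q2 -> le q2 q1 -> q1 = q2.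
  move=> [q1 q1P] [q2 q2P] /asboolP/= q12 /asboolP/= q21.
  by apply/eq_exist/funext => x; apply/le_anti; rewrite q12 q21.
have [||F chF|[q [sq qp]] qmin] := Zorn _ _ le_asym.
- by move=> q; apply/asboolP.
- by move=> q1 q2 q3 /asboolP q12 /asboolP q23; apply/asboolP => x;
    rewrite (le_trans (q23 x)).
(* The empty chain is bounded by [p], a nonempty one by its pointwise infimum [g]. *)
- have [[q0 Fq0]|F0] := pselect (F !=set0); last first.
    have pE : sublinear p /\ forall x, p x <= p x by [].
    by exists (exist _ p pE) => q Fq; exfalso; apply: F0; exists q.
  pose S x := [set sval q x | q in F].
  have S0 x : S x !=set0 by exists (sval q0 x), q0.
  have Slb x : lbound (S x) (- p (- x)).
    move=> _ [q Fq <-]; apply: le_trans (sublinearN x (svalP q).1).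
    by rewrite lerN2 (svalP q).2.
  have Sle x q : F q -> inf (S x) <= sval q x.
    by move=> Fq; apply: ge_inf; [exists (- p (- x))|exists q].
  pose g x := inf (S x).
  have gE : sublinear g /\ forall x, g x <= p x.
    split; last by move=> x; rewrite (le_trans (Sle x q0 Fq0))// (svalP q0).2.
    have gZ t x : 0 <= t -> t * g x <= g (t *: x).
      move=> t0; apply: lb_le_inf => // _ [q Fq <-].
      by rewrite (svalP q).1.2// ler_wpM2l// Sle.
    have g0 : g 0 <= 0.
      by rewrite (le_trans (Sle 0 q0 Fq0))// (sublinear0 (svalP q0).1).
    split=> [x y|t x].
      rewrite -lerBlDr; apply: lb_le_inf => // _ [q1 Fq1 <-].
      rewrite lerBlDr -lerBlDl; apply: lb_le_inf => // _ [q2 Fq2 <-].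
      (* In a chain [q1] and [q2] are comparable, and subadditivity of the smaller one bounds
         [g (x + y)]. *)
      rewrite lerBlDl; have [/asboolP h|/asboolP h] := chF _ _ Fq1 Fq2.
        rewrite (le_trans (Sle _ _ Fq2))// (le_trans ((svalP q2).1.1 x y))//.
        by rewrite lerD2r h.
      rewrite (le_trans (Sle _ _ Fq1))// (le_trans ((svalP q1).1.1 x y))//.
      by rewrite lerD2l h.
    rewrite le_eqVlt => /predU1P[<-|t0].
      by apply/le_anti; rewrite {1}scale0r mul0r g0/= -[leLHS](mul0r (g x)) gZ.
    apply/le_anti; rewrite (gZ _ _ (ltW t0)) andbT.
    have := gZ t^-1 (t *: x); rewrite invr_ge0 => /(_ (ltW t0)).
    by rewrite scalerA mulVf ?gt_eqF// scale1r ler_pdivrMl.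
  by exists (exist _ g gE) => q Fq; apply/asboolP => x; exact: Sle.
have qN x : q (- x) = - q x.
  have cx := @convex_set_singleton _ _ x.
  have [|r [sr rq rx]] :=
      sublinear_separation sq (ex_intro _ x erefl) cx (m := q x).
    by move=> _ ->.
  have rE : sublinear r /\ forall y, r y <= p y.
    by split=> // y; rewrite (le_trans (rq y)).
  have /(congr1 sval)/= E' := qmin (exist _ r rE) (asboolT rq).
  apply/le_anti; rewrite -{1}E' rx//=.
  by have := sublinearN (- x) sq; rewrite opprK.
exists q; split=> // a x y.
(* By oddness of [q], superadditivity is subadditivity at [- u] and [- v]. *)
have qD u v : q (u + v) = q u + q v.
  apply/le_anti; rewrite sq.1/= -lerN2 -qN !opprD -!qN; exact: sq.1.
rewrite qD; congr (_ + _); have [a0|a0] := leP 0 a; first exact: sq.2.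
rewrite -[a]opprK scaleNr qN sq.2 ?oppr_ge0 ?ltW//.
by rewrite -mulNr.
Qed.

(** * Continuous functionals on a normed space *)

Lemma linear_funP (R : realType) (X : lmodType R) (f : X -> R^o) :
  linear f -> exists g : {linear X -> R^o}, g = f :> (X -> R^o).
Proof.
move=> lf.
pose g : {linear X -> R^o} := HB.pack f (GRing.isLinear.Build _ _ _ _ f lf).
by exists g.
Qed.

(** A linear [f] below the functional that separates [C] from the norm satisfies [f (- c) <= - d] on
    [C]. It lies below the norm at both [x] and [- x], hence is bounded and continuous. *)
Lemma norm_separation (R : realType) (X : normedModType R) (C : set X) (d : R) :
  C !=set0 -> convex_set (C : set (convex_lmodType X)) ->
  (forall c, C c -> d <= `|c|) ->
  exists f : X -> R^o, [/\ dual f, forall x, f x <= `|x| &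
    forall c, C c -> d <= f c].
Proof.
move=> C0 cC dC.
have sn : sublinear (fun x : X => `|x|).
  split=> [x y|t x t0]; first exact: ler_normD.
  by rewrite normrZ ger0_norm.
have [q [sq qn qC]] := sublinear_separation sn C0 cC dC.
have [f [lf fq]] := sublinear_ge_linear sq.
have [g gf] := linear_funP lf.
have fN x : f (- x) = - f x by rewrite -gf linearN.
have fn x : f x <= `|x| by rewrite (le_trans (fq x)).
exists f; split=> //; last first.
  by move=> c Cc; rewrite -lerN2 -fN (le_trans (fq _))// qC.
split=> //; rewrite -gf; apply: bounded_linear_continuous.
apply/linear_boundedP; near=> r => x; rewrite (@le_trans _ _ `|x|)//.
  by rewrite gf ler_norml fn andbT lerNl -fN -(normrN x) fn.
by rewrite ler_peMl//; near: r; exact: nbhs_pinfty_ge.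
Unshelve. all: by end_near. Qed.

Lemma norming_functional (R : realType) (X : normedModType R) (z : X) :
  exists f : X -> R^o, [/\ dual f, forall x, f x <= `|x| & f z = `|z|].
Proof.
have [|f [df fn fz]] :=
    norm_separation (ex_intro _ z erefl) (@convex_set_singleton _ _ z)
      (d := `|z|).
  by move=> _ ->.
by exists f; split=> //; apply/le_anti; rewrite fn fz.
Qed.

(** Continuity bounds [f] on the unit ball, so that the [sup] in [dual_norm] is a true supremum;
    rescaling to the unit ball does the rest. *)
Lemma dual_bounded (R : realType) (X : normedModType R) (f : X -> R^o) :
  dual f -> 0 <= dual_norm f /\ forall x, `|f x| <= dual_norm f * `|x|.
Proof.
move=> [lf cf]; have [g gf] := linear_funP lf.
have hs : has_sup [set `|f x| | x in [set x : X | `|x| <= 1]].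
  split; first by exists `|f 0|, 0 => //=; rewrite normr0.
  have /linear_bounded_continuous/linear_boundedP : continuous g by rewrite gf.
  move=> /pinfty_ex_gt0 [M M0 gM]; exists M => _ [x /= x1 <-].
  by rewrite -gf (le_trans (gM x))// ler_piMr// ltW.
split=> [|x].
  apply: le_trans (normr_ge0 (f 0)) _.
  by apply: (sup_upper_bound hs); exists 0; rewrite //= normr0.
have [->|x0] := eqVneq x 0.
  by rewrite -gf linear0 !normr0 mulr0.
rewrite -ler_pdivrMr ?normr_gt0//.
apply: (sup_upper_bound hs); exists (`|x|^-1 *: x).
  by rewrite /= normrZ normfV normr_id mulVf ?normr_eq0.
by rewrite -gf linearZ normrM normfV normr_id mulrC.
Qed.

(** * Limits along ultrafilters *)

Lemma ultra_bounded_cvg (R : realType) (T : Type) (U : set_system T)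
    (h : T -> R) (M : R) :
  UltraFilter U -> (forall t, `|h t| <= M) ->
  exists l : R, h t @[t --> U] --> l.
Proof.
move=> UU hM.
have FU : ProperFilter (h @ U) by exact: fmap_proper_filter.
(* Compactness gives a cluster point, and the image of an ultrafilter converges to each of its
   cluster points. *)
have /(_ (h @ U) FU) [|l [_ hl]] := @segment_compact R (- M) M.
  apply: (@filterS _ U _ setT) => [t _ /=|]; last exact: filterT.
  by rewrite in_itv /= -ler_norml.
exists l => V nV; have [//|UnV] := in_ultra_setVsetC (h @^-1` V) UU.
by have [x []] := hl (~` V) V UnV nV.
Qed.

(* Reflexivity is applied to the functional [f |-> lim_U f (u t)]. *)
Lemma reflexive_ultra_limit (R : realType) (X : normedModType R) (T : Type)
    (U : set_system T) (u : T -> X) (M : R) :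
  reflexive_space X -> UltraFilter U -> (forall t, `|u t| <= M) ->
  exists z, forall f : X -> R^o, dual f -> f (u t) @[t --> U] --> f z.
Proof.
move=> rX UU uM.
have cv f : dual f -> f (u t) @[t --> U] --> lim (f (u t) @[t --> U]).
  move=> df; have fM t : `|f (u t)| <= dual_norm f * M.
    have [f0 fb] := dual_bounded df.
    by rewrite (le_trans (fb _))// ler_wpM2l.
  by have [l hl] := ultra_bounded_cvg UU fM; apply/cvg_ex; exists l.
pose Phi (f : X -> R^o) := lim (f (u t) @[t --> U]) : R.
have [|z zE] := rX Phi; last first.
  by exists z => f df; rewrite -zE//; exact: cv.
split=> [a f g df dg|].
  apply/cvg_lim => //; apply: cvgD; last exact: cv.
  by apply: cvgMr; exact: cv.
exists M => f df; apply: (cvgr_to_le (cvg_norm (cv f df))).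
apply: nearW => t; have [f0 fb] := dual_bounded df.
by rewrite mulrC (le_trans (fb _))// ler_wpM2l.
Qed.

(** Otherwise [F] and the complement of [V] generate a proper filter, and an ultrafilter above it
    contains [F] but not [V]. *)
Lemma ultra_near (T : Type) (F : set_system T) (V : set T) :
  ProperFilter F -> (forall U, UltraFilter U -> F `<=` U -> U V) -> F V.
Proof.
move=> FF UV; apply: contrapT => nFV.
have FW : ProperFilter (within (~` V) F).
  apply: Build_ProperFilter_ex => P FP; apply: contrapT => nP.
  apply: nFV; apply: (@filterS _ F _ [set t | (~` V) t -> P t]) FP => t Pt.
  apply: contrapT => nVt.
  by apply: nP; exists t; exact: Pt.
have [U [UU FU]] := ultraFilterLemma FW.
have UV' : U V by apply: UV => // P FP; apply: FU; apply: filterS FP => t Pt _.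
have UnV : U (~` V) by apply: FU; exact: withinT.
by have /filter_ex[x []] : U (V `&` ~` V) by exact: filterI.
Qed.

(** * Minimizing sequences in a convex set *)

Lemma strictly_convex_face (R : realType) (X : normedModType R) (f : X -> R^o)
    (d : R) (x y : X) :
  strictly_convex X -> linear f -> (forall x, f x <= `|x|) -> 0 < d ->
  `|x| <= d -> `|y| <= d -> f x = d -> f y = d -> x = y.
Proof.
move=> sX lf fn d0 xd yd fx fy; apply/eqP; apply: contrapT => /negP xy.
have [g gf] := linear_funP lf.
have nx : `|x| = d by apply/le_anti; rewrite xd -[leLHS]fx fn.
have ny : `|y| = d by apply/le_anti; rewrite yd -[leLHS]fy fn.
have n1 (z : X) : `|z| = d -> `|d^-1 *: z| = 1.
  by move=> nz; rewrite normrZ gtr0_norm ?invr_gt0// nz mulVf ?gt_eqF.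
have dxy : d^-1 *: x != d^-1 *: y.
  by rewrite (inj_eq (scalerI _))// invr_eq0 gt_eqF.
(* At the midpoint of the normalized points [f] equals 1, so the norm there is at least 1, against
   strict convexity. *)
have := sX _ _ (n1 _ nx) (n1 _ ny) dxy.
apply/negP; rewrite -leNgt (le_trans _ (fn _))//.
rewrite -gf linearZ linearD !linearZ /= gf fx fy.
rewrite /GRing.scale/= mulVf ?gt_eqF//; lra.
Qed.

Lemma minimizing_seq_cvg (R : realType) (X : normedModType R) (C : set X)
    (d : R) :
  reflexive_space X -> strictly_convex X -> property_H X ->
  C !=set0 -> convex_set (C : set (convex_lmodType X)) ->
  (forall c, C c -> d <= `|c|) ->
  exists z : X, forall u : nat -> X, (forall n, C (u n)) ->
    `|u n| @[n --> \oo] --> d -> u n @[n --> \oo] --> z.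
Proof.
move=> rX sX HX C0 cC dC.
(* If [d <= 0], the norms are eventually below every positive [e], so the limit is 0. Otherwise
   division by [d] makes sense. *)
have [d0|d0] := leP d 0.
  exists 0 => u _ ud; apply/cvgr0Pnorm_lt => e e0.
  by apply: cvgr_lt ud _ _; exact: le_lt_trans e0.
have [f [df fn fC]] := norm_separation C0 cC dC.
have W (u : nat -> X) U : (forall n, C (u n)) -> `|u n| @[n --> \oo] --> d ->
    UltraFilter U -> \oo `<=` U -> exists z, [/\ `|z| <= d, f z = d &
      forall g, dual g -> g (u n) @[n --> U] --> g z].
  move=> Cu ud UU ooU.
  have [M uM] : exists M, forall n, `|u n| <= M.
    have /cvg_seq_bounded/pinfty_ex_gt0[M M0 uM] : cvgn (fun n => `|u n|).
      by apply/cvg_ex; exists d.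
    by exists M => n; have := uM n Logic.I; rewrite /= normr_id.
  have [z gz] := reflexive_ultra_limit rX UU uM.
  (* Weak lower semicontinuity of the norm, tested on a functional that norms [z]. *)
  have zd : `|z| <= d.
    apply/ler_addgt0Pr => e e0; have [g [dg gn <-]] := norming_functional z.
    apply: (cvgr_to_le (gz g dg)); apply: ooU.
    have : \forall n \near \oo, `|u n| <= d + e.
      by apply: cvgr_le ud _ _; rewrite ltrDl.
    by apply: filterS => n; apply: le_trans.
  exists z; split=> //; apply/le_anti; rewrite (le_trans (fn z))//=.
  by apply: (cvgr_to_ge (gz f df)); apply: nearW => n; exact: fC.
(* The point [z] must serve all minimizing sequences, so it is read off from an arbitrary one; if
   there is none, 0 is a default value. *)
have [[u0 [Cu0 u0d]]|noU] := pselect (exists u : nat -> X,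
    (forall n, C (u n)) /\ `|u n| @[n --> \oo] --> d); last first.
  by exists 0 => u Cu ud; exfalso; apply: noU; exists u.
have [U0 [UU0 ooU0]] := ultraFilterLemma (@eventually_filter).
have [z [zd fz _]] := W u0 U0 Cu0 u0d UU0 ooU0.
exists z => u Cu ud.
have uz : weakly_cvg u z.
  move=> g dg V Vg; apply: (@ultra_near nat \oo [set n | V (g (u n))]).
  move=> U UU ooU.
  have [z' [zd' fz' gz']] := W u U Cu ud UU ooU.
  have zz' : z = z' by apply: (strictly_convex_face sX df.1 fn d0).
  by rewrite zz' in Vg; exact: (gz' g dg).
have un0 n : `|u n| != 0 by rewrite gt_eqF// (lt_le_trans d0)// dC.
(* Property (H) concerns the unit sphere: the sequence is normalized first and scaled back
   afterwards. *)
have vz : (`|u n|^-1 *: u n) @[n --> \oo] --> d^-1 *: z.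
  apply: HX => [n||g dg].
  - by rewrite normrZ normfV normr_id mulVf.
  - have nz : `|z| = d by apply/le_anti; rewrite zd -[leLHS]fz fn.
    by rewrite normrZ gtr0_norm ?invr_gt0// nz mulVf ?gt_eqF.
  have [h hg] := linear_funP dg.1.
  have -> : g (d^-1 *: z) = d^-1 * g z by rewrite -hg linearZ.
  rewrite (_ : (fun n => _) = (fun n => `|u n|^-1 * g (u n))); last first.
    by apply/funext => n; rewrite -hg linearZ.
  by apply: cvgM; [apply: cvgV; rewrite ?gt_eqF|exact: uz].
rewrite (_ : u = fun n => `|u n| *: (`|u n|^-1 *: u n)); last first.
  by apply/funext => n; rewrite scalerA divff// scale1r.
rewrite -[z](scale1r) -(divff (lt0r_neq0 d0)) -scalerA.
exact: cvgZ.
Qed.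

(** Points violating the claim for each [r = 1 / (n + 1)] would form a minimizing sequence that
    stays at distance at least [e] from [z]. *)
Lemma minimizing_norm_close (R : realType) (X : normedModType R) (C : set X)
    (d : R) :
  reflexive_space X -> strictly_convex X -> property_H X ->
  C !=set0 -> convex_set (C : set (convex_lmodType X)) ->
  (forall c, C c -> d <= `|c|) ->
  exists z, forall e, 0 < e -> exists2 r, 0 < r &
    forall c, C c -> `|c| < d + r -> `|c - z| < e.
Proof.
move=> rX sX HX C0 cC dC.
have [z zP] := minimizing_seq_cvg rX sX HX C0 cC dC.
exists z => e e0; apply: contrapT => nr.
have /choice[u uP] n :
    exists c, [/\ C c, `|c| < d + n.+1%:R^-1 & e <= `|c - z|].
  apply: contrapT => nc; apply: nr; exists n.+1%:R^-1.
    by rewrite invr_gt0.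
  move=> c Cc cn; rewrite ltNge; apply/negP => ec.
  by apply: nc; exists c.
have ud : `|u n| @[n --> \oo] --> d.
  apply: (@squeeze_cvgr _ _ _ _ (fun=> d) (fun n => d + n.+1%:R^-1)).
  - by apply: nearW => n; have [Cu uh _] := uP n; rewrite dC//= ltW.
  - exact: cvg_cst.
  - rewrite -[X in _ --> X]addr0; apply: cvgD; first exact: cvg_cst.
    exact: cvg_harmonic.
have Cu n : C (u n) by have [] := uP n.
have /cvgrPdist_lt/(_ e e0)[N _ /(_ N (leqnn N))] := zP u Cu ud.
by have [_ _] := uP N; rewrite distrC ltNge => ->.
Qed.

(** * Best proximity points of cyclic contractions *)

Lemma convex_setB (R : realType) (X : lmodType R) (A B : set X) :
  convex_set (A : set (convex_lmodType X)) ->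
  convex_set (B : set (convex_lmodType X)) ->
  convex_set ([set x - y | x in A & y in B] : set (convex_lmodType X)).
Proof.
move=> /convex_setP cA /convex_setP cB; apply/convex_setP.
move=> _ _ t [x Ax [y By <-]] [x' Ax' [y' By' <-]] t01.
exists (t *: x + (1 - t) *: x'); first exact: cA.
exists (t *: y + (1 - t) *: y'); first exact: cB.
by rewrite !scalerBr opprD addrACA.
Qed.

Lemma set_dist_le (R : realType) (X : normedModType R) (A B : set X) (x y : X) :
  A x -> B y -> set_dist A B <= `|x - y|.
Proof.
move=> Ax By; apply: ge_inf; last by exists x => //; exists y.
by exists 0 => _ [u _ [v _ <-]].
Qed.

(** Every pair realizing the distance has difference [z], so [p = q] once [T q] is at minimal
    distance from both. *)
Lemma best_proximity_unique (R : realType) (X : normedModType R) (A B : set X)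
    (T : X -> X) (z p q : X) :
  cyclic_contraction A B T ->
  (forall x y, A x -> B y -> `|x - y| <= set_dist A B -> x - y = z) ->
  B p -> B q -> `|p - T p| = set_dist A B -> `|q - T q| = set_dist A B -> p = q.
Proof.
move=> [TA TB [k [k0 k1 kT]]] zP Bp Bq; rewrite ![`|_ - T _|]distrC => pd qd.
have {}TA x : A x -> B (T x) by move=> Ax; apply: TA; exists x.
have {}TB x : B x -> A (T x) by move=> Bx; apply: TB; exists x.
(* Both [T x - x] and [T x - T (T x)] have minimal norm, so both equal [z]. *)
have TT x : B x -> `|T x - x| = set_dist A B -> T (T x) = x.
  move=> Bx xd; apply: oppr_inj; apply: (addrI (T x)).
  rewrite (zP _ _ (TB _ Bx) Bx) ?xd// zP//; [exact: TB|exact/TA/TB|].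
  rewrite distrC (le_trans (kT _ _ (TB _ Bx) Bx))// xd; lra.
(* As [T] applied twice fixes [p] and [q], the two inequalities bound the excess of the norm of
   [T q - p] over the distance by [k ^+ 2] times itself; hence it vanishes. *)
have h1 := kT _ _ (TB _ Bp) Bq; have h2 := kT _ _ (TB _ Bq) Bp.
rewrite !TT// [`|p - _|]distrC in h1; rewrite !TT// [`|q - _|]distrC in h2.
have h3 := set_dist_le (TB _ Bp) Bq; have h4 := set_dist_le (TB _ Bq) Bp.
have qp : `|T q - p| <= set_dist A B by nra.
apply: oppr_inj; apply: (addrI (T q)).
by rewrite (zP _ _ (TB _ Bq) Bp)// zP ?qd//; exact: TB.
Qed.

Lemma cyclic_contraction_even_iter_cvg (R : realType)
    (X : completeNormedModType R) (A B : set X) (T : X -> X) (z b : X) :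
  cyclic_contraction A B T -> closed B ->
  (forall e, 0 < e -> exists2 r, 0 < r & forall x y, A x -> B y ->
    `|x - y| < set_dist A B + r -> `|x - y - z| < e) ->
  B b -> exists p : X, [/\ B p, `|p - T p| = set_dist A B &
    iter (2 * n) T b @[n --> \oo] --> p].
Proof.
move=> [TA TB [k [k0 k1 kT]]] cB zP Bb.
have {}TA x : A x -> B (T x) by move=> Ax; apply: TA; exists x.
have {}TB x : B x -> A (T x) by move=> Bx; apply: TB; exists x.
(* The even iterates [y n] stay in [B], the odd ones [w n] in [A]. *)
pose d := set_dist A B; pose y n := iter (2 * n) T b; pose w n := T (y n).
have yS n : y n.+1 = T (w n) by rewrite /w /y mulnS !addSn add0n !iterS.
have By n : B (y n) by elim: n => [//|n IH]; rewrite yS; exact/TA/TB.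
have Aw n : A (w n) by exact: TB.
have gap n m : `|w n - y m.+1| <= k * `|w m - y n| + (1 - k) * d.
  by rewrite yS distrC; exact: kT.
(* Two applications of [T] shrink the excess by [k ^+ 2], weakened here to [k]. *)
have gap' n m : `|w n.+1 - y m.+1| <= k * `|w n - y m| + (1 - k) * d.
  rewrite (le_trans (gap _ _))// lerD2r ler_pM2l//.
  have := set_dist_le (Aw n) (By m); rewrite -/d => dn.
  have := gap m n; nra.
have dwy n m : d <= `|w n - y m| by exact: set_dist_le.
have small r : 0 < r -> exists N, forall n, (N <= n)%N -> `|w n - y n| < d + r.
  move=> r0; pose K := `|w 0%N - y 0%N| - d.
  have geo n : `|w n - y n| - d <= K * k ^+ n.
    elim: n => [|n IH]; first by rewrite expr0 mulr1.
    rewrite exprS mulrCA; have := gap' n n; nra.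
  have : K * k ^+ n @[n --> \oo] --> K * 0.
    by apply: cvgMr; apply: cvg_expr; rewrite gtr0_norm.
  rewrite mulr0 => /cvgr0Pnorm_lt/(_ r r0)[N _ NK]; exists N => n /NK /= Kn.
  by rewrite -ltrBlDl (le_lt_trans (geo n))// (le_lt_trans (ler_norm _)).
have near_z e : 0 < e -> exists N, forall n, (N <= n)%N ->
    `|w n - y n - z| < e /\ `|w n - y n.+1 - z| < e.
  move=> /zP[r r0 rP]; have [N NP] := small r r0; exists N => n /NP wy.
  split; apply: rP => //.
  rewrite (le_lt_trans _ wy)// (le_trans (gap n n))//.
  have := dwy n n; nra.
(* The differences [w n - y n] tend to [z] while their norms tend to [d]. *)
have zd : `|z| <= d.
  apply/ler_addgt0Pr => e e0; have e2 : 0 < e / 2 by lra.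
  have [N NP] := near_z _ e2; have [N' NP'] := small _ e2.
  have [h _] := NP _ (leq_maxl N N'); have := NP' _ (leq_maxr N N').
  have := ler_distD (w (maxn N N') - y (maxn N N')) z 0; rewrite !subr0.
  rewrite distrC in h; lra.
have ycauchy : cauchy_ex (y n @[n --> \oo]).
  move=> e e0; have [r r0 rP] := zP e e0.
  (* Both [w N] and [w N.+1] will be this close to [y N.+1 + z], hence within [(1 - k) * (r / 2)] of
     each other. *)
  have r4 : 0 < (1 - k) * (r / 4) by nra.
  have [N1 NP1] := near_z _ r4.
  have r2 : 0 < r / 2 by lra.
  have [N2 NP2] := small _ r2.
  pose N := maxn N1 N2.
  have [_ h1] := NP1 N (leq_maxl _ _).
  have [h2 _] := NP1 N.+1 (leqW (leq_maxl _ _)).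
  have hw : `|w N - w N.+1| <= (1 - k) * (r / 2).
    have := ler_distD (y N.+1 + z) (w N) (w N.+1).
    by rewrite [`|y N.+1 + z - _|]distrC !opprD !addrA; lra.
  (* The bound reproduces itself: [gap'] shrinks the excess [r / 2] to [k * (r / 2)], and passing
     from [w N.+1] back to [w N] costs less than [(1 - k) * (r / 2)]. *)
  have hy m : `|w N - y (N + m)%N| < d + r / 2.
    elim: m => [|m IH]; first by rewrite addn0 NP2// leq_maxr.
    rewrite addnS (le_lt_trans (ler_distD (w N.+1) _ _))//.
    have := gap' N (N + m)%N; nra.
  (* The centre of the ball need not be a term of the sequence: [w N - y n] is close to [z] for all
     [n >= N]. *)
  exists (w N - z); exists N => // n /= Nn; rewrite -ball_normE /=.
  rewrite addrAC; apply: rP => //; rewrite -(subnKC Nn).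
  by rewrite (lt_trans (hy _))// ltrD2l; lra.
have /cauchy_cvg/cvg_ex[p yp] : cauchy (y n @[n --> \oo]) by exact: cauchy_exP.
have Bp : B p by apply: (closed_cvg B cB _ _ yp); exact: nearW.
exists p; split=> //; rewrite distrC; apply/le_anti.
rewrite (set_dist_le (TB _ Bp) Bp) andbT.
apply/ler_addgt0Pr => e e0; have e3 : 0 < e / 3 by lra.
have [N NP] := near_z _ e3; have /cvgrPdist_lt/(_ _ e3)[M _ MP] := yp.
pose n := maxn N M.
have [h1 _] := NP n (leq_maxl _ _).
have /= h2 := MP n (leq_maxr _ _).
have /= h3 := MP n.+1 (leqW (leq_maxr _ _)).
(* The image [T p] is compared with [y n.+1 = T (w n)] by contraction; the norm of [w n - p] is
   nearly at most [d], since [w n] is close to [p + z]. *)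
have h4 := kT _ _ (Aw n) Bp; rewrite -yS [`|_ - T p|]distrC in h4.
have h5 : `|w n - p| <= `|w n - y n - z| + `|z| + `|p - y n|.
  rewrite [`|p - _|]distrC -{1}(subrK (y n) (w n)) -{1}(subrK z (w n - y n)).
  by rewrite -addrA (le_trans (ler_normD _ _))// lerD2r ler_normD.
have := ler_distD (y n.+1) (T p) p; rewrite [`|y _ - p|]distrC -/d => h6.
rewrite -/d in h4; nra.
Qed.

Theorem corollary4p11 (R : realType) (X : completeNormedModType R)
    (A B : set X) (T : X -> X)
    (X_reflexive : reflexive_space X) (X_strictly_convex : strictly_convex X)
    (X_H : property_H X)
    (A_neq0 : A !=set0) (A_closed : closed A)
    (A_convex : convex_set (A : set (convex_lmodType X)))
    (B_neq0 : B !=set0) (B_closed : closed B)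
    (B_convex : convex_set (B : set (convex_lmodType X)))
    (T_cyclic : cyclic_contraction A B T) :
  exists b0 : X, B `&` best_proximity_points A B T = [set b0] /\
    forall b : X, B b -> iter (2 * n) T b @[n --> \oo] --> b0.
Proof.
have [a Aa] := A_neq0; have [b Bb] := B_neq0.
pose C : set X := [set x - y | x in A & y in B].
have C0 : C !=set0 by exists (a - b), a => //; exists b.
have dC c : C c -> set_dist A B <= `|c|.
  by move=> [x Ax [y By <-]]; exact: set_dist_le.
have [z zP] := minimizing_norm_close X_reflexive X_strictly_convex X_H C0
  (convex_setB A_convex B_convex) dC.
have near_z e : 0 < e -> exists2 r, 0 < r & forall x y, A x -> B y ->
    `|x - y| < set_dist A B + r -> `|x - y - z| < e.
  move=> /zP[r r0 rP]; exists r => // x y Ax By; apply: rP.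
  by exists x => //; exists y.
(* A pair at minimal distance satisfies the closeness condition for every [e], so its difference is
   [z] exactly. *)
have eq_z x y : A x -> B y -> `|x - y| <= set_dist A B -> x - y = z.
  move=> Ax By xy; apply/eqP; rewrite -subr_eq0 -normr_le0.
  apply/ler_addgt0Pr => e /near_z[r r0 rP]; rewrite add0r ltW// rP//.
  by rewrite (le_lt_trans xy)// ltrDl.
have conv := cyclic_contraction_even_iter_cvg T_cyclic B_closed near_z.
have [b0 [Bb0 b0d _]] := conv b Bb; exists b0; split.
  apply/seteqP; split=> [q [Bq [_ qd]]|_ ->].
    exact: (best_proximity_unique T_cyclic eq_z).
  by split=> //; split=> //; right.
move=> c /conv[p [Bp pd]].
by rewrite (best_proximity_unique T_cyclic eq_z Bp Bb0 pd b0d).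
Qed.
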